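(* For general graphs, the ratios $\Gamma_b(G)/\alpha_{\mathrm{bnr}}(G)$ and $\Gamma_b(G)/\alpha_{\mathrm{bn}}(G)$ are unbounded; that is, for every real number $M$ there exist a graph $G$ with $\Gamma_b(G)/\alpha_{\mathrm{bnr}}(G)>M$ and a graph $G'$ with $\Gamma_b(G')/\alpha_{\mathrm{bn}}(G')>M$.
   Context: All graphs are finite and simple. Let $d(u,v)$ denote distance and $e(v)$ the eccentricity of $v$. A broadcast on a connected graph $G=(V,E)$ is a function $f:V\to\{0,1,\dots,\operatorname{diam}(G)\}$ with $f(v)\le e(v)$ for all $v\in V$ if $|V|\ge 2$, and $f(v)=1$ if $V=\{v\}$. On a disconnected graph, a broadcast is a union of broadcasts on its components. Let $V_f^+=\{v: f(v)>0\}$ and $\sigma(f)=\sum_{v\in V}f(v)$ (the weight). A vertex $u$ hears $f$ from $v\in V_f^+$ (and $v$ dominates $u$) if $d(u,v)\le f(v)$. $f$ is dominating if every vertex hears $f$ from some vertex of $V_f^+$. A dominating broadcast $f$ is minimal dominating if no broadcast $g\neq f$ with $g(v)\le f(v)$ for all $v$ is dominating. $\Gamma_b(G)$ is the maximum weight of a minimal dominating broadcast of $G$. For $v\in V_f^+$ let $N_f(v)=\{u:d(u,v)\le f(v)\}$, $B_f(v)=\{u:d(u,v)=f(v)\}$, and let the private boundary $\operatorname{PB}_f(v)$ be the set of $u\in N_f(v)$ that are not dominated by the function obtained from $f$ by changing the value at $v$ to $f(v)-1$. $f$ is irredundant if $\operatorname{PB}_f(v)\ne\varnothing$ for each $v\in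 V_f^+$. $f$ is bn-independent if $N_f(u)\cap N_f(v)\subseteq B_f(u)\cap B_f(v)$ for all distinct $u,v\in V_f^+$; it is bnr-independent if it is bn-independent and irredundant. $\alpha_{\mathrm{bn}}(G)$ and $\alpha_{\mathrm{bnr}}(G)$ are the maximum weights of a bn-independent and a bnr-independent broadcast on $G$, respectively. *)

(* Defs.v *)
From mathcomp Require Import all_boot.

Set Implicit Arguments.
Unset Strict Implicit.
Unset Printing Implicit Defensive.

Record sgraph := SGraph {
  vertex :> finType;
  adj : rel vertex;
  adj_sym : symmetric adj;
  adj_irrefl : irreflexive adj
}.

Section Graph.
Variable G : sgraph.
Implicit Types u v w : G.

Definition walk (n : nat) u v : bool :=
  [exists p : n.-tuple G, path (@adj G) u p && (last u p == v)].

Definition component v : {set G} := [set u | connect (@adj G) v u].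

(* The length of a shortest walk.  For u, v in different components this
   returns the junk value #|G|; every use below is guarded by [component]. *)
Definition dist u v : nat := find (fun n => walk n u v) (iota 0 #|G|).

(* Eccentricity of v inside its own component. *)
Definition ecc v : nat := \max_(u in component v) dist u v.

Implicit Type f g : G -> nat.

(* A union of broadcasts on the components: the value on a one-vertex component
   is 1, and elsewhere it is bounded by the eccentricity in the component (hence
   also by the diameter of the component). *)
Definition broadcast f : bool :=
  [forall v, if #|component v| == 1 then f v == 1 else f v <= ecc v].

Definition weight f : nat := \sum_(v : G) f v.

Definition supp f : {set G} := [set v | 0 < f v].

Definition nbhd f v : {set G} := [set u in component v | dist u v <= f v].

Definition bdry f v : {set G} := [set u in component v | dist u v == f v].

Definition dominated f u : bool := [exists v in supp f, u \in nbhd f v].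

Definition dominating f : bool := [forall u, dominated f u].

Definition lower f v : G -> nat := fun u => if u == v then (f v).-1 else f u.

Definition pbdry f v : {set G} := [set u in nbhd f v | ~~ dominated (lower f v) u].

Definition irredundant f : bool := [forall v in supp f, pbdry f v != set0].

Definition bn_independent f : bool :=
  [forall u in supp f, forall v in supp f, (u != v) ==>
     (nbhd f u :&: nbhd f v \subset bdry f u :&: bdry f v)].

Definition bnr_independent f : bool := bn_independent f && irredundant f.

(* A finite type of functions that contains every broadcast (see
   [broadcast_leq] and [broadcast_bfun]), used to take maxima over broadcasts
   and to quantify over them in bool. *)
Definition bfun := {ffun G -> 'I_#|G|.+1}.

Definition bfun_val (F : bfun) : G -> nat := fun v => F v.

Lemma broadcast_leq f v : broadcast f -> f v <= #|G|.
Proof.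
move=> /forallP/(_ v); case: ifP => _ h.
  by rewrite (eqP h); apply/card_gt0P; exists v.
apply: leq_trans h _; apply/bigmax_leqP => u _.
by rewrite /dist -[leqRHS](size_iota 0) find_size.
Qed.

Lemma broadcast_bfun f : broadcast f -> exists F : bfun, bfun_val F =1 f.
Proof.
move=> bf; exists [ffun v => inord (f v)] => v.
by rewrite /bfun_val ffunE inordK // ltnS broadcast_leq.
Qed.

End Graph.

Coercion bfun_val : bfun >-> Funclass.

Definition minimal_dominating (G : sgraph) (f : G -> nat) : bool :=
  [&& broadcast f, dominating f &
   ~~ [exists g : bfun G, [&& broadcast g, [exists v, g v != f v],
                              [forall v, g v <= f v] & dominating g]]].

Definition Gamma_b (G : sgraph) : nat :=
  \max_(f : bfun G | minimal_dominating f) weight f.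

Definition alpha_bn (G : sgraph) : nat :=
  \max_(f : bfun G | broadcast f && bn_independent f) weight f.

Definition alpha_bnr (G : sgraph) : nat :=
  \max_(f : bfun G | broadcast f && bnr_independent f) weight f.

(* Main.v *)
Require Import Defs.
From mathcomp Require Import all_boot all_order all_algebra.
From mathcomp Require Import boolp reals.

Set Implicit Arguments.
Unset Strict Implicit.
Unset Printing Implicit Defensive.

Import Order.TTheory GRing.Theory Num.Theory.
Local Open Scope ring_scope.

(** One family of graphs gives both halves: the prism over a complete graph,
    the Cartesian product of [K_n] and [K_2], that is two n-cliques joined by a
    perfect matching.

    Giving the value 1 to every vertex of one clique and 0 to the other is a
    minimal dominating broadcast, since each vertex of the first clique is the
    only one that dominates its partner in the second ([leq_Gamma_b_prism]).
    Hence [Gamma_b] is at least n.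

    On the other hand [alpha_bn] is at most 2 ([alpha_bn_prism]).  In a
    bn-independent broadcast no broadcasting vertex hears another one
    ([bn_independent_unheard]).  The diameter is at most 2, so a vertex with
    value at least 2 is heard everywhere, hence broadcasts alone, and its
    value is at most 2.  If all the values are at most 1, the broadcasting
    vertices are pairwise nonadjacent, so each clique contains at most one.

    Every bnr-independent broadcast is bn-independent, so [alpha_bnr] is at most
    2 as well.  Division by zero is 0 in a field, so a positive lower bound on
    [alpha_bnr] is needed too: a single vertex with value 1 provides it. *)

(** * Distances and extremal broadcasts on arbitrary graphs *)

Section Generic.
Local Open Scope nat_scope.
Variable G : sgraph.
Implicit Types (u v : G) (f : G -> nat).

Lemma dist_leq n u v : walk n u v -> dist u v <= n.
Proof.
move=> wn; have [n_lt|n_ge] := ltnP n #|G|; last first.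
  by apply: leq_trans n_ge; rewrite -[leqRHS](size_iota 0) find_size.
rewrite leqNgt; apply/negP => n_lt_dist.
have := before_find 0 n_lt_dist.
by rewrite nth_iota // add0n wn.
Qed.

Lemma distxx u : dist u u = 0.
Proof.
apply/eqP; rewrite -leqn0; apply: dist_leq.
by apply/existsP; exists [tuple] => /=.
Qed.

Lemma dist_adj u v : adj u v -> dist u v <= 1.
Proof.
move=> uv; apply: dist_leq; apply/existsP; exists [tuple v].
by rewrite /= uv /=.
Qed.

Lemma walk_dist u v : dist u v < #|G| -> walk (dist u v) u v.
Proof.
move=> d_lt.
have : has (fun n => walk n u v) (iota 0 #|G|) by rewrite has_find size_iota.
by move=> /(nth_find 0); rewrite -/(dist u v) nth_iota.
Qed.

Lemma dist_eq0P u v : dist u v = 0 -> u = v.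
Proof.
move=> d0; have /walk_dist : dist u v < #|G|.
  by rewrite d0; apply/card_gt0P; exists u.
by rewrite d0 => /existsP[p]; rewrite (tuple0 p) => /= /eqP.
Qed.

Lemma dist_leq1P u v : 1 < #|G| -> dist u v <= 1 -> u = v \/ adj u v.
Proof.
move=> G1 d1; have := walk_dist (leq_ltn_trans d1 G1).
case: (dist u v) d1 => [|[|//]] _ /existsP[p].
  by rewrite (tuple0 p) => /= /eqP; left.
by case/tupleP: p => x p; rewrite (tuple0 p) /= andbT => /andP[? /eqP <-]; right.
Qed.

Lemma component_refl u : u \in component u.
Proof. by rewrite inE connect0. Qed.

(** The vertex v lies in its own ball but not on the boundary of that ball. *)
Lemma bn_independent_unheard f u v :
  bn_independent f -> 0 < f u -> 0 < f v -> u != v -> v \notin nbhd f u.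
Proof.
move=> /forall_inP bn fu fv uv; apply/negP => vu.
have /forall_inP/(_ v) : [forall v in supp f, (u != v) ==>
  (nbhd f u :&: nbhd f v \subset bdry f u :&: bdry f v)] by apply: bn; rewrite inE.
rewrite inE => /(_ fv); rewrite uv /= => /subsetP/(_ v).
rewrite inE vu inE component_refl distxx leq0n => /(_ isT).
by rewrite !inE distxx => /andP[_ /andP[_ /eqP f0]]; rewrite -f0 in fv.
Qed.

Lemma leq_Gamma_b f : minimal_dominating f -> weight f <= Gamma_b G.
Proof.
move=> mf; have /andP[bf _] := mf.
have [F /funext FE] := broadcast_bfun bf; rewrite -FE in mf *.
exact: leq_bigmax_cond.
Qed.

Lemma leq_alpha_bnr f :
  broadcast f -> bnr_independent f -> weight f <= alpha_bnr G.
Proof.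
move=> bf rf; have [F /funext FE] := broadcast_bfun bf; rewrite -FE in bf rf *.
by rewrite /alpha_bnr (bigop.bigmax_sup F) // bf rf.
Qed.

Lemma alpha_bnr_leq_bn : alpha_bnr G <= alpha_bn G.
Proof.
apply/bigmax_leqP => F /andP[bF /andP[bnF _]].
by rewrite /alpha_bn (bigop.bigmax_sup F) // bF bnF.
Qed.

(** The private boundary of the only broadcasting vertex is its whole ball. *)
Lemma bnr_independent_single v : bnr_independent (fun u => (u == v) : nat).
Proof.
apply/andP; split.
  apply/forall_inP => x; rewrite inE lt0b => /eqP ->.
  apply/forall_inP => y; rewrite inE lt0b => /eqP ->.
  by rewrite eqxx.
apply/forall_inP => x; rewrite inE lt0b => /eqP ->.
apply/set0Pn; exists v; rewrite !inE connect0 distxx /=.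
apply/exists_inP => -[w]; rewrite inE /lower eqxx /=.
by case: ifP => // ->.
Qed.

End Generic.

(** * The prism over a complete graph *)

Section Prism.
Local Open Scope nat_scope.
Variable n : nat.

Let V := (bool * 'I_n.+1)%type.

(** For two distinct vertices: equal first components mean the same clique,
    equal second components mean that the matching joins them. *)
Definition prism_adj (x y : V) : bool :=
  (x != y) && ((x.1 == y.1) || (x.2 == y.2)).

Lemma prism_adj_sym : symmetric prism_adj.
Proof.
by move=> x y; rewrite /prism_adj eq_sym (eq_sym x.1) (eq_sym x.2).
Qed.

Lemma prism_adj_irrefl : irreflexive prism_adj.
Proof. by move=> x; rewrite /prism_adj eqxx. Qed.

Definition prism : sgraph := SGraph prism_adj_sym prism_adj_irrefl.
Implicit Types x y : prism.

Lemma card_prism : #|prism| = 2 * n.+1.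
Proof. by rewrite card_prod card_bool card_ord. Qed.

Lemma card_prism_gt1 : 1 < #|prism|.
Proof. by rewrite card_prism mulnS. Qed.

Lemma prism_dist_aligned x y :
  (x.1 == y.1) || (x.2 == y.2) -> dist x y <= 1.
Proof.
move=> xy; have [->|nxy] := eqVneq x y; first by rewrite distxx.
by apply: dist_adj; rewrite /= /prism_adj nxy.
Qed.

Lemma prism_walk2 x y : x.1 != y.1 -> x.2 != y.2 ->
  let z : prism := (x.1, y.2) in adj x z /\ adj z y.
Proof.
case: x y => a i [b j] /= ab ij.
by rewrite /prism_adj !xpair_eqE /= !eqxx /= (negPf ab) (negPf ij) orbT.
Qed.

Lemma prism_dist_leq2 x y : dist x y <= 2.
Proof.
have [e1|n1] := eqVneq x.1 y.1.
  by apply: leqW; apply: prism_dist_aligned; rewrite e1 eqxx.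
have [e2|n2] := eqVneq x.2 y.2.
  by apply: leqW; apply: prism_dist_aligned; rewrite e2 eqxx orbT.
have [xz zy] := prism_walk2 n1 n2.
apply: dist_leq; apply/existsP; exists [tuple (x.1, y.2) : prism; y].
by rewrite /= in xz zy *; rewrite xz zy eqxx.
Qed.

Lemma prism_component x y : y \in component x.
Proof.
rewrite inE; have [->|nxy] := eqVneq x y; first exact: connect0.
case: (boolP ((x.1 == y.1) || (x.2 == y.2))) => [a|].
  by apply: connect1; rewrite /= /prism_adj nxy.
rewrite negb_or => /andP[n1 n2]; have [xz zy] := prism_walk2 n1 n2.
exact: connect_trans (connect1 xz) (connect1 zy).
Qed.

Lemma prism_nbhd (f : prism -> nat) x y :
  (y \in nbhd f x) = (dist y x <= f x).
Proof. by rewrite in_set prism_component. Qed.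

Lemma card_prism_component x : #|component x| != 1.
Proof.
rewrite (_ : component x = setT); last first.
  by apply/setP => y; rewrite prism_component inE.
by rewrite cardsT; have := card_prism_gt1; case: #|_| => [|[]].
Qed.

Lemma prism_ecc_leq2 x : ecc x <= 2.
Proof. by apply/bigmax_leqP => y _; exact: prism_dist_leq2. Qed.

Lemma prism_ecc_gt0 x : 0 < ecc x.
Proof.
pose y : prism := (~~ x.1, x.2).
have xy : x != y by apply/eqP => /(congr1 fst) /=; case: (x.1).
rewrite /ecc (bigop.bigmax_sup y) ?prism_component // lt0n; apply/eqP => d0.
by rewrite (dist_eq0P d0) eqxx in xy.
Qed.

Lemma prism_broadcast01 (f : prism -> nat) : (forall x, f x <= 1) -> broadcast f.
Proof.
move=> f1; apply/forallP => x; rewrite (negPf (card_prism_component x)).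
exact: leq_trans (f1 x) (prism_ecc_gt0 x).
Qed.

(** A value of at least 2 covers the whole graph, as the diameter is at most 2,
    and so silences all the other vertices.  Otherwise the weight counts the
    broadcasting vertices, at most one in each clique. *)
Lemma bn_independent_weight_prism (f : prism -> nat) :
  broadcast f -> bn_independent f -> weight f <= 2.
Proof.
move=> /forallP bf bnf.
case: (boolP [exists x, 2 <= f x]) => [/existsP[x fx2]|].
  rewrite /weight (bigD1 x) //= big1 => [|y yx].
    rewrite addn0; have := bf x; rewrite (negPf (card_prism_component x)).
    by move=> /leq_trans; apply; exact: prism_ecc_leq2.
  apply/eqP; rewrite -leqn0 leqNgt; apply/negP => fy.
  rewrite eq_sym in yx.
  have /negP := bn_independent_unheard bnf (ltnW fx2) fy yx.
  by apply; rewrite prism_nbhd (leq_trans (prism_dist_leq2 y x)).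
rewrite negb_exists => /forallP f_lt2.
have -> : weight f = #|supp f|.
  rewrite -sum1_card /weight [RHS]big_mkcond; apply: eq_bigr => x _.
  by rewrite inE; have := f_lt2 x; case: (f x) => [|[]].
rewrite -card_bool -(@card_in_imset _ _ (fun x : prism => x.1) (mem (supp f))).
  exact: max_card.
move=> x y; rewrite !inE => fx fy exy; apply/eqP/negPn/negP => nxy.
have /negP := bn_independent_unheard bnf fx fy nxy; apply.
rewrite prism_nbhd; apply: leq_trans fx.
by apply: prism_dist_aligned; rewrite exy eqxx.
Qed.

Lemma alpha_bn_prism : alpha_bn prism <= 2.
Proof.
by apply/bigmax_leqP => f /andP[]; exact: bn_independent_weight_prism.
Qed.

Lemma alpha_bnr_prism_gt0 : 0 < alpha_bnr prism.
Proof.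
pose v : prism := (true, ord0).
apply: (@leq_trans (weight (fun u : prism => (u == v) : nat))).
  by rewrite /weight (bigD1 v) //= eqxx.
apply: leq_alpha_bnr; last exact: bnr_independent_single.
by apply: prism_broadcast01 => x; exact: leq_b1.
Qed.

(** Broadcasting 1 from the whole clique [true] is minimal: when x stops, the
    partner of x in the other clique hears nobody. *)
Lemma leq_Gamma_b_prism : n.+1 <= Gamma_b prism.
Proof.
pose f (x : prism) : nat := x.1.
have -> : n.+1 = weight f.
  rewrite /weight -(pair_bigA _ (fun (b : bool) (_ : 'I_n.+1) => b : nat)) /=.
  by rewrite big_bool /= !sum_nat_const card_ord muln1 muln0 addn0.
apply: leq_Gamma_b; apply/and3P; split.
- by apply: prism_broadcast01 => x; exact: leq_b1.
- apply/forallP => x; apply/exists_inP; exists ((true, x.2) : prism).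
    by rewrite inE.
  by rewrite prism_nbhd; apply: prism_dist_aligned; rewrite eqxx orbT.
apply/existsP => -[F]; move: (bfun_val F) => g.
move=> /and4P[_ /existsP[x gfx] /forallP gf /forallP dg].
have [x1 gx] : x.1 /\ g x = 0.
  have := gf x; move: gfx; rewrite /f.
  by case: (x.1) => /=; case: (g x) => [|[]].
have /exists_inP[z] := dg ((false, x.2) : prism).
rewrite inE => gz; have z1 : z.1.
  by have := leq_trans gz (gf z); rewrite /f lt0b.
rewrite prism_nbhd => d; have {}d : dist ((false, x.2) : prism) z <= 1.
  by apply: leq_trans d (leq_trans (gf z) (leq_b1 _)).
have zx : z = x.
  case: (dist_leq1P card_prism_gt1 d) => [ez|/=].
    by rewrite -ez in z1.
  rewrite /prism_adj /= z1 /= => /andP[_ /eqP e2].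
  by apply: injective_projections; rewrite ?z1 ?x1.
by rewrite zx gx in gz.
Qed.

End Prism.

Theorem theorem5p4 (R : realType) (M : R) :
  (exists G : sgraph,
     (0 < #|G|)%N /\ (Gamma_b G)%:R / (alpha_bnr G)%:R > M) /\
  (exists G' : sgraph,
     (0 < #|G'|)%N /\ (Gamma_b G')%:R / (alpha_bn G')%:R > M).
Proof.
(* The absolute value covers the case of a negative M. *)
pose n := Num.bound (`|M| * 2).
have ratio a : (0 < a)%N -> (a <= 2)%N -> (Gamma_b (prism n))%:R / a%:R > M.
  move=> a0 a2; rewrite ltr_pdivlMr ?ltr0n //.
  have Ma : M * a%:R <= `|M| * 2.
    apply: le_trans (ler_wpM2r (ler0n _ _) (ler_norm M)) _.
    by rewrite ler_wpM2l ?normr_ge0 // ler_nat.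
  apply: le_lt_trans Ma (lt_le_trans (archi_boundP _) _); first exact: mulr_ge0.
  by rewrite ler_nat (leq_trans (leqnSn n)) // leq_Gamma_b_prism.
have bnr0 := alpha_bnr_prism_gt0 n.
have le_bnr := alpha_bnr_leq_bn (prism n).
have G0 : (0 < #|prism n|)%N := ltnW (card_prism_gt1 n).
have bn2 := alpha_bn_prism n.
split; exists (prism n); split=> //; apply: ratio => //.
  exact: leq_trans le_bnr bn2.
exact: leq_trans bnr0 le_bnr.
Qed.
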